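(* Let $r\ge 1$ be an integer and let $a_1,\dots,a_r,z_1,\dots,z_r$ be indeterminates. Then, as an identity of formal power series in $q$ (with coefficients polynomials in $a_1,\dots,a_r,z_1,\dots,z_r$), \begin{align*} &\frac{(-a_{1} z_1 q;q)_{\infty}(-a_{2} z_2 q;q)_{\infty}\cdots(-a_{r} z_r q;q)_{\infty}}{(a_{1}q;q)_{\infty}(a_{2}q;q)_{\infty}\cdots(a_{r}q;q)_{\infty}}\\ &\quad=1+\sum_{N=1}^{\infty}q^{N^{2}}\prod_{j=1}^{r}\frac{(-a_{j} z_j q;q)_{N-1}}{(a_{j}q;q)_{N-1}} \sum_{\substack{i_1,\dots,i_r\ge 0\\ i_{1}+i_{2}+\cdots+i_{r}=N}}\frac{a_{1}^{i_{1}}a_{2}^{i_{2}}\cdots a_{r}^{i_{r}}(-z_1;q)_{i_{1}}(-z_2;q)_{i_{2}}\cdots(-z_r;q)_{i_{r}}}{(q;q)_{i_{1}}(q;q)_{i_{2}}\cdots(q;q)_{i_{r}}}\\ &\qquad\qquad\times \left(1+\sum_{s=1}^{r}q^{i_1+i_2+\cdots+i_{s-1}}\left(1+z_s q^{i_s}\right) \frac{a_s q^N}{1-a_s q^N} \prod_{k=1}^{s-1} \frac{1+a_k z_k q^N}{1-a_k q^N}\right). \end{align*}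
   Context: Standard $q$-Pochhammer notation: $(a;q)_n=\prod_{k=0}^{n-1}(1-aq^k)$ (so $(a;q)_0=1$) and $(a;q)_\infty=\prod_{k=0}^{\infty}(1-aq^k)$. For $s=1$ the exponent $i_1+\cdots+i_{s-1}$ is the empty sum $0$ and the product $\prod_{k=1}^{s-1}$ is the empty product $1$. The factors $1/(1-a_sq^N)$ are expanded as geometric series in $q$. *)

(* Defs.v *)
From HB Require Import structures.
From mathcomp Require Import all_boot all_order all_algebra.
From mathcomp Require Import boolp.
From mathcomp Require Export mpoly.

Set Implicit Arguments.
Unset Strict Implicit.
Unset Printing Implicit Defensive.

Import GRing.Theory.
Local Open Scope ring_scope.

(* The series sum_n (fps_coef f n) q^n. *)
Record fps (R : Type) : Type := Fps { fps_coef :> nat -> R }.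

Notation "{ 'fps' R }" := (fps R) (at level 0, format "{ 'fps'  R }").

Lemma fpsP (R : Type) (f g : {fps R}) : (forall n, f n = g n) <-> f = g.
Proof.
split=> [|-> //]; case: f g => [f] [g] /= fg.
by congr Fps; apply: funext.
Qed.

HB.instance Definition _ (R : Type) := gen_eqMixin {fps R}.
HB.instance Definition _ (R : Type) := gen_choiceMixin {fps R}.

Section FpsRing.
Variable R : comNzRingType.
Implicit Types f g h : {fps R}.

Definition fpsC (c : R) : {fps R} := Fps (fun n => if n is 0%N then c else 0).
Definition fps_add f g : {fps R} := Fps (fun n => f n + g n).
Definition fps_opp f : {fps R} := Fps (fun n => - f n).
Definition fps_mul f g : {fps R} :=
  Fps (fun n => \sum_(i < n.+1) f i * g (n - i)%N).

Fact fps_addA : associative fps_add.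
Proof. by move=> f g h; apply/fpsP => n /=; rewrite addrA. Qed.
Fact fps_addC : commutative fps_add.
Proof. by move=> f g; apply/fpsP => n /=; rewrite addrC. Qed.
Fact fps_add0 : left_id (fpsC 0) fps_add.
Proof. by move=> f; apply/fpsP => -[|n] /=; rewrite add0r. Qed.
Fact fps_addN : left_inverse (fpsC 0) fps_opp fps_add.
Proof. by move=> f; apply/fpsP => -[|n] /=; rewrite addNr. Qed.

HB.instance Definition _ :=
  GRing.isZmodule.Build {fps R} fps_addA fps_addC fps_add0 fps_addN.

Let trunc n f : {poly R} := \poly_(i < n.+1) f i.

Let coef_trunc n f i : (i <= n)%N -> (trunc n f)`_i = f i.
Proof. by move=> lein; rewrite coef_poly ltnS lein. Qed.

Let coef_truncM n f g i : (i <= n)%N ->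
  (trunc n f * trunc n g)`_i = fps_mul f g i.
Proof.
move=> lein; rewrite coefM; apply: eq_bigr => j _.
by rewrite !coef_trunc // (leq_trans _ lein) ?leq_subr // -ltnS ltn_ord.
Qed.

Fact fps_mulA : associative fps_mul.
Proof.
move=> f g h; apply/fpsP => n.
transitivity (trunc n f * (trunc n g * trunc n h))`_n.
  rewrite coefM; apply: eq_bigr => i _.
  by rewrite coef_trunc ?coef_truncM ?leq_subr // -ltnS.
rewrite mulrA coefM; apply: eq_bigr => i _.
by rewrite coef_truncM ?coef_trunc ?leq_subr // -ltnS.
Qed.

Fact fps_mulC : commutative fps_mul.
Proof.
by move=> f g; apply/fpsP => n; rewrite -!(@coef_truncM n) // mulrC.
Qed.

Fact fps_mul1 : left_id (fpsC 1) fps_mul.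
Proof.
move=> f; apply/fpsP => n /=; rewrite big_ord_recl /= subn0 mul1r.
by rewrite big1 ?addr0 // => i _; rewrite mul0r.
Qed.

Fact fps_mulDl : left_distributive fps_mul fps_add.
Proof.
move=> f g h; apply/fpsP => n /=; rewrite -big_split /=.
by apply: eq_bigr => i _; rewrite mulrDl.
Qed.

Fact fps_one_neq0 : fpsC 1 != 0.
Proof. by apply/eqP => /fpsP/(_ 0%N)/eqP; rewrite /= oner_eq0. Qed.

HB.instance Definition _ := GRing.Zmodule_isComNzRing.Build {fps R}
  fps_mulA fps_mulC fps_mul1 fps_mulDl fps_one_neq0.

Lemma fps_coef0 n : (0 : {fps R}) n = 0. Proof. by case: n. Qed.
Lemma fps_coef1 n : (1 : {fps R}) n = (n == 0%N)%:R. Proof. by case: n. Qed.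
Lemma fps_coefD f g n : (f + g) n = f n + g n. Proof. by []. Qed.
Lemma fps_coefN f n : (- f) n = - f n. Proof. by []. Qed.
Lemma fps_coefB f g n : (f - g) n = f n - g n. Proof. by []. Qed.
Lemma fps_coefM f g n : (f * g) n = \sum_(i < n.+1) f i * g (n - i)%N.
Proof. by []. Qed.
Lemma fps_coefM0 f g : (f * g) 0%N = f 0%N * g 0%N.
Proof. by rewrite fps_coefM big_ord1. Qed.
Lemma fps_coefC c n : fpsC c n = if n is 0%N then c else 0.
Proof. by []. Qed.
Lemma fps_coefCM c f n : (fpsC c * f) n = c * f n.
Proof.
rewrite fps_coefM big_ord_recl /= subn0 big1 ?addr0 // => i _.
by rewrite mul0r.
Qed.
Lemma fps_coef_sum (I : Type) (s : seq I) (P : pred I) (F : I -> {fps R}) n :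
  (\sum_(i <- s | P i) F i) n = \sum_(i <- s | P i) F i n.
Proof.
by apply: (big_morph (fun f : {fps R} => f n)) => //; rewrite fps_coef0.
Qed.

Definition fpsX : {fps R} := Fps (fun n => (n == 1%N)%:R).

Lemma fps_expM_low f g m n : f 0%N = 0 -> (n < m)%N -> (f ^+ m * g) n = 0.
Proof.
move=> f0; elim: m n => [//|m IHm] n; rewrite ltnS => lenm.
rewrite exprS -mulrA fps_coefM big_ord_recl f0 mul0r add0r big1 // => i _.
rewrite IHm ?mulr0 // lift0.
have ltin := ltn_ord i; rewrite (leq_trans _ lenm) // ltn_subrL /=.
by apply: leq_ltn_trans ltin.
Qed.

Definition fps_cvg_to (u : nat -> {fps R}) (l : {fps R}) : Prop :=
  forall n, exists M, forall m, (M <= m)%N -> u m n = l n.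

(* The limit of u in the q-adic topology; 0 if u does not converge. *)
Definition fps_lim (u : nat -> {fps R}) : {fps R} :=
  if pselect (exists l, fps_cvg_to u l) is left ul then projT1 (cid ul) else 0.

Definition fps_sum (m : nat) (t : nat -> {fps R}) : {fps R} :=
  fps_lim (fun M => \sum_(m <= N < M) t N).

Lemma fps_cvg_unique (u : nat -> {fps R}) l l' : fps_cvg_to u l -> fps_cvg_to u l' -> l = l'.
Proof.
move=> ul ul'; apply/fpsP => n; have [M uM] := ul n; have [M' uM'] := ul' n.
by rewrite -(uM (maxn M M')) ?leq_maxl // uM' ?leq_maxr.
Qed.

Lemma fps_cvg_lim (u : nat -> {fps R}) l : fps_cvg_to u l -> fps_lim u = l.
Proof.
move=> ul; rewrite /fps_lim; case: pselect => [ex|[]]; last by exists l.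
by case: (cid ex) => l' /= /fps_cvg_unique; apply.
Qed.

Lemma fps_cauchy_cvg (u : nat -> {fps R}) :
    (forall m n, (n < m)%N -> u m.+1 n = u m n) ->
  fps_cvg_to u (Fps (fun n => u n.+1 n)).
Proof.
move=> uS n; exists n.+1 => m /= /subnK <-.
by elim: (m - n.+1)%N => // k IHk; rewrite addSn uS ?IHk // leq_addl.
Qed.

Lemma fps_sum_cvg m (t : nat -> {fps R}) : (forall N n, (n < N)%N -> t N n = 0) ->
  fps_cvg_to (fun M => \sum_(m <= N < M) t N) (fps_sum m t).
Proof.
move=> t0; have /fps_cauchy_cvg tl M n : (n < M)%N ->
    (\sum_(m <= N < M.+1) t N) n = (\sum_(m <= N < M) t N) n.
  move=> ltnM; have [lemM|ltMm] := leqP m M.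
    by rewrite big_nat_recr //= t0 ?addr0.
  by rewrite !big_geq // ltnW.
by rewrite /fps_sum (fps_cvg_lim tl).
Qed.

End FpsRing.

Arguments fpsX {R}.
Arguments fps_coef : simpl never.
Notation "c %:S" := (fpsC c) (at level 2, format "c %:S") : ring_scope.

Section FpsUnitRing.
Variable R : comUnitRingType.
Implicit Types f g : {fps R}.

Definition fps_unit : pred {fps R} := fun f => f 0%N \is a GRing.unit.

(* With c the inverse of the constant term of f, f^-1 is the geometric series  *)
(* c * sum_k (1 - c f)^k, whose terms k > n do not contribute to q^n.          *)
Definition fps_inv f : {fps R} :=
  if fps_unit f then
    let c := (f 0%N)^-1 in
    Fps (fun n => (c%:S * \sum_(k < n.+1) (1 - c%:S * f) ^+ k) n)
  else f.

Fact fps_mulVr : {in fps_unit, left_inverse 1 fps_inv *%R}.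
Proof.
move=> f fU; have {}fU : fps_unit f by [].
rewrite /fps_inv fU mulrC; set c := _^-1; set h := 1 - _.
have h0 : h 0%N = 0.
  by rewrite /h fps_coefB fps_coefCM fps_coef1 mulVr ?subrr.
apply/fpsP => n.
transitivity ((f * (c%:S * \sum_(k < n.+1) h ^+ k)) n).
  rewrite !fps_coefM; apply: eq_bigr => i _; congr (_ * _).
  transitivity ((c%:S * \sum_(k < (n - i).+1) h ^+ k) (n - i)%N); first by [].
  rewrite !fps_coefCM; congr (_ * _); rewrite !fps_coef_sum.
  have lein : ((n - i).+1 <= n.+1)%N by rewrite ltnS leq_subr.
  rewrite (big_ord_widen _ (fun k => (h ^+ k) (n - i)%N) lein).
  rewrite big_mkcond; apply: eq_bigr => k _; case: ifPn => //.
  by rewrite -leqNgt => ltk; rewrite -[h ^+ k]mulr1 fps_expM_low.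
have -> : f * (c%:S * \sum_(k < n.+1) h ^+ k) = 1 - h ^+ n.+1.
  rewrite -[X in X - _](expr1n _ n.+1) subrXX mulrA (mulrC f).
  congr (_ * _); first by rewrite /h opprB addrC subrK.
  by apply: eq_bigr => i _; rewrite expr1n mul1r.
by rewrite fps_coefB -[h ^+ n.+1]mulr1 fps_expM_low ?subr0.
Qed.

Fact fps_unitP f g : g * f = 1 -> fps_unit f.
Proof.
move=> /(congr1 (fun h : {fps R} => h 0%N)); rewrite fps_coefM0 => gf1.
by apply/unitrPr; exists (g 0%N); rewrite mulrC.
Qed.

Fact fps_inv_out : {in [predC fps_unit], fps_inv =1 id}.
Proof. by move=> f /negbTE fU; rewrite /fps_inv [fps_unit f]fU. Qed.

HB.instance Definition _ := GRing.ComNzRing_hasMulInverse.Build {fps R}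
  fps_mulVr fps_unitP fps_inv_out.

Lemma fps_unitE f : (f \is a GRing.unit) = (f 0%N \is a GRing.unit).
Proof. by []. Qed.

End FpsUnitRing.

Definition qpoch (A : comNzRingType) (a q : A) (n : nat) : A :=
  \prod_(k < n) (1 - a * q ^+ k).

Definition qpoch_inf (R : comNzRingType) (a q : {fps R}) : {fps R} :=
  fps_lim (qpoch a q).

Lemma qpoch_inf_cvg (R : comNzRingType) (a q : {fps R}) :
  q 0%N = 0 -> fps_cvg_to (qpoch a q) (qpoch_inf a q).
Proof.
move=> q0; have /fps_cauchy_cvg al m n : (n < m)%N ->
    qpoch a q m.+1 n = qpoch a q m n.
  move=> ltnm; rewrite /qpoch big_ord_recr /= mulrBr mulr1 mulrA mulrC.
  by rewrite fps_coefB fps_expM_low ?subr0.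
by rewrite /qpoch_inf (fps_cvg_lim al).
Qed.

Lemma qpoch_unit (R : comUnitRingType) (a q : {fps R}) n :
  q 0%N = 0 -> qpoch (a * q) q n \is a GRing.unit.
Proof.
move=> q0; apply: rpred_prod => k _.
rewrite fps_unitE fps_coefB fps_coef1 -mulrA -exprS exprSr !fps_coefM0 q0.
by rewrite !mulr0 subr0 unitr1.
Qed.

Lemma qpoch_inf_unit (R : comUnitRingType) (a q : {fps R}) :
  q 0%N = 0 -> qpoch_inf (a * q) q \is a GRing.unit.
Proof.
move=> q0; have [M aM] := @qpoch_inf_cvg R (a * q) q q0 0%N.
by rewrite fps_unitE -(aM M) // -fps_unitE qpoch_unit.
Qed.

(* Main.v *)
(* Let w(i) = prod_j a_j^{i_j} (-z_j;q)_{i_j} / (q;q)_{i_j} and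
   |i| = i_1 + ... + i_r, and put
     C_N(t) = sum_{|i| <= N} w(i) t^|i|,
     P_N    = prod_j (-a_j z_j q;q)_N / (a_j q;q)_N,
     R_j(t) = (1 + a_j z_j t) / (1 - a_j t).
   The N-th summand of the right-hand side is S_N - S_{N-1}, where
   S_N = P_N C_N(q^{N+1}).  As S_0 = 1 and C_N(q^{N+1}) tends to 1, summing over
   N gives the limit of P_N, which is the left-hand side.  The summand is
   identified by replacing t by tq in C_N(t) one coordinate at a time, each
   time multiplying by R_s(t): without truncation nothing would change, since
   sum_n w_s(n) t^n = R_s(t) sum_n w_s(n) (tq)^n, and the truncation error is
   the s-th term of the sum over s, supported on |i| = N. *)
Require Import Defs.
From mathcomp Require Import all_boot all_order all_algebra.
From mathcomp Require Import ring zify.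

Import GRing.Theory.
Local Open Scope ring_scope.

Lemma prodrV (A : comUnitRingType) (I : Type) (s : seq I) (P : pred I)
    (F : I -> A) :
  (forall i, F i \is a GRing.unit) ->
  (\prod_(i <- s | P i) F i)^-1 = \prod_(i <- s | P i) (F i)^-1.
Proof.
move=> FU; elim: s => [|i s IHs]; first by rewrite !big_nil invr1.
by rewrite !big_cons; case: ifP => // _; rewrite invrM ?rpred_prod // mulrC IHs.
Qed.

Lemma qpochS (A : comNzRingType) (a q : A) n :
  qpoch a q n.+1 = qpoch a q n * (1 - a * q ^+ n).
Proof. by rewrite /qpoch big_ord_recr. Qed.

Lemma sum_add_delta (r : nat) (P : pred 'I_r) (s : 'I_r) (f g : 'I_r -> nat) :
  (forall j, g j = (f j + (j == s))%N) ->
  (\sum_(j < r | P j) g j = \sum_(j < r | P j) f j + P s)%N.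
Proof.
move=> gE; rewrite (eq_bigr _ (fun j _ => gE j)) big_split /=; congr (_ + _)%N.
have [Ps|nPs] := boolP (P s); last first.
  by rewrite big1 // => j Pj; case: eqP => // js; rewrite -js Pj in nPs.
by rewrite (bigD1 s) //= eqxx big1 // => j /andP[_ /negbTE->].
Qed.

(** * Reindexing sums over bounded tuples *)

Section BoundedTuples.
Variables (A : nmodType) (r : nat).

(** The tuples with a positive [s]-th entry are the shifts i + e_s of tuples of sum below [N], and
    [X] kills the others. *)
Lemma sum_tuple_incr N (s : 'I_r) (X Y : {ffun 'I_r -> 'I_N.+1} -> A) :
  (forall i : {ffun 'I_r -> 'I_N.+1}, i s = 0%N :> nat -> X i = 0) ->
  (forall i i' : {ffun 'I_r -> 'I_N.+1},
     (forall j, i' j = (i j + (j == s))%N :> nat) -> X i' = Y i) ->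
  \sum_(i : {ffun 'I_r -> 'I_N.+1} | (\sum_(j < r) i j <= N)%N) X i
    = \sum_(i : {ffun 'I_r -> 'I_N.+1} | (\sum_(j < r) i j < N)%N) Y i.
Proof.
move=> X0 XY.
rewrite (bigID (fun i : {ffun _ -> 'I_N.+1} => 0 < i s)%N) /=.
rewrite [X in _ + X]big1 ?addr0; last first.
  by move=> i /andP[_]; rewrite -eqn0Ngt => /eqP /X0.
pose up (i : {ffun 'I_r -> 'I_N.+1}) : {ffun 'I_r -> 'I_N.+1} :=
  [ffun j => inord (i j + (j == s))%N].
pose down (i : {ffun 'I_r -> 'I_N.+1}) : {ffun 'I_r -> 'I_N.+1} :=
  [ffun j => inord (i j - (j == s))%N].
have upE (i : {ffun 'I_r -> 'I_N.+1}) j :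
    (i s < N)%N -> up i j = (i j + (j == s))%N :> nat.
  move=> ltN; rewrite ffunE inordK //; case: eqP => [->|_].
    by rewrite addn1.
  by rewrite addn0.
have downE (i : {ffun 'I_r -> 'I_N.+1}) j :
    down i j = (i j - (j == s))%N :> nat.
  by rewrite ffunE inordK // (leq_ltn_trans (leq_subr _ _)).
have upK (i : {ffun 'I_r -> 'I_N.+1}) : (i s < N)%N -> down (up i) = i.
  by move=> ltN; apply/ffunP => j; apply/val_inj; rewrite /= downE upE // addnK.
have sum_up (i : {ffun 'I_r -> 'I_N.+1}) :
    (i s < N)%N -> (\sum_j up i j = (\sum_j i j).+1)%N.
  move=> ltN; rewrite -[RHS]addn1.
  exact: (sum_add_delta r predT s (fun j => i j) _ (fun j => upE i j ltN)).
have le_sum (i : {ffun 'I_r -> 'I_N.+1}) : (i s <= \sum_j i j)%N.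
  by rewrite (bigD1 s) //= leq_addr.
rewrite (reindex_onto up down) /=; last first.
  move=> i /andP[_ i_gt0]; apply/ffunP => j; apply/val_inj.
  have lt_down : (down i s < N)%N.
    by rewrite downE eqxx; have := ltn_ord (i s); lia.
  rewrite /= upE // downE.
  by case: eqP => [->|_]; rewrite ?subn0 ?addn0 // subnK.
(* For [i s = N] the entry N + 1 is out of range and [inord] returns 0, so positivity picks out
   exactly the tuples that [up] really shifts. *)
have up_gt0 (i : {ffun 'I_r -> 'I_N.+1}) : (0 < up i s)%N = (i s < N)%N.
  by rewrite ffunE eqxx addn1 /inord val_insubd ltnS; case: ifP.
apply: eq_big => [i|i]; rewrite up_gt0; last first.
  by move=> /andP[/andP[_ ltN] _]; apply: XY => j; apply: upE.
have [ltN|geN] := ltnP (i s) N; first by rewrite sum_up // upK // eqxx !andbT.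
by rewrite andbF; apply/esym/negbTE; rewrite -leqNgt (leq_trans geN).
Qed.

(** The bound on the sum already forces every entry to be at most [N]. This lets C_N and C_(N+1),
    indexed by different types, be compared. *)
Lemma sum_tuple_widen N (X : {ffun 'I_r -> 'I_N.+2} -> A)
    (Y : {ffun 'I_r -> 'I_N.+1} -> A) :
  (forall (i : {ffun 'I_r -> 'I_N.+2}) (i' : {ffun 'I_r -> 'I_N.+1}),
     (forall j, i j = i' j :> nat) -> X i = Y i') ->
  \sum_(i : {ffun 'I_r -> 'I_N.+2} | (\sum_(j < r) i j <= N)%N) X i
  = \sum_(i : {ffun 'I_r -> 'I_N.+1} | (\sum_(j < r) i j <= N)%N) Y i.
Proof.
move=> XY.
pose wid (i : {ffun 'I_r -> 'I_N.+1}) : {ffun 'I_r -> 'I_N.+2} :=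
  [ffun j => inord (i j)].
pose nar (i : {ffun 'I_r -> 'I_N.+2}) : {ffun 'I_r -> 'I_N.+1} :=
  [ffun j => inord (i j)].
have widE (i : {ffun 'I_r -> 'I_N.+1}) j : wid i j = i j :> nat.
  by rewrite ffunE inordK // ltnW // ltnS.
rewrite (reindex_onto wid nar) /=; last first.
  move=> i le_iN; apply/ffunP => j; apply/val_inj.
  rewrite /= widE ffunE inordK // ltnS (leq_trans _ le_iN) //.
  by rewrite (bigD1 j) //= leq_addr.
apply: eq_big => [i|i _]; last exact/XY/widE.
rewrite (eq_bigr _ (fun j _ => widE i j)).
suff -> : nar (wid i) = i by rewrite eqxx andbT.
by apply/ffunP => j; apply/val_inj; rewrite ffunE widE inord_val.
Qed.

End BoundedTuples.

(** * The finite identity behind each summand *)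

Section FiniteIdentity.
Variables (A : comUnitRingType) (r : nat) (a z : 'I_r -> A) (q : A).
Hypothesis qU : forall n, 1 - q ^+ n.+1 \is a GRing.unit.

(** By the q-binomial theorem, the coefficient of t^n in (-a_j z_j t; q)_oo / (a_j t; q)_oo. *)
Let weight (j : 'I_r) n := a j ^+ n * qpoch (- z j) q n / qpoch q q n.

Definition tuple_weight {K : nat} (i : {ffun 'I_r -> 'I_K}) : A :=
  \prod_(j < r) weight j (i j).

Definition weight_series N (t : A) : A :=
  \sum_(i : {ffun 'I_r -> 'I_N.+1} | (\sum_(j < r) i j <= N)%N)
     tuple_weight i * t ^+ (\sum_(j < r) i j)%N.

Lemma qpoch_qq_unit n : qpoch q q n \is a GRing.unit.
Proof. by apply: rpred_prod => k _; rewrite -exprS. Qed.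

(** This is the functional equation (1 - a_j t) f(t) = (1 + a_j z_j t) f(tq) of the generating
    series f of [weight j], read off at t^(n+1). *)
Lemma weightS j n :
  weight j n.+1 * (1 - q ^+ n.+1) = a j * (1 + z j * q ^+ n) * weight j n.
Proof.
rewrite /weight !qpochS -exprS invrM ?qpoch_qq_unit // mulNr opprK.
set p := (qpoch q q n)^-1; set u := 1 - q ^+ n.+1.
transitivity (a j * (1 + z j * q ^+ n) * (a j ^+ n * qpoch (- z j) q n * p)
              * (u^-1 * u)); first by rewrite exprS; ring.
by rewrite mulVr ?mulr1 ?qU.
Qed.

Lemma tuple_weightE K (i : {ffun 'I_r -> 'I_K}) :
  tuple_weight i = (\prod_(j < r) a j ^+ i j)
    * (\prod_(j < r) qpoch (- z j) q (i j)) / (\prod_(j < r) qpoch q q (i j)).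
Proof.
rewrite prodrV => [|j]; last exact: qpoch_qq_unit.
by rewrite -!big_split.
Qed.

(* The recurrence [weightS] makes the left-hand side telescope along
   i |-> i + e_s, so that only the tuples with |i| = N survive. *)
Lemma truncation_step N (s : 'I_r) (t : A) :
  let S (F : {ffun 'I_r -> 'I_N.+1} -> A) (P : pred nat) :=
    \sum_(i : {ffun 'I_r -> 'I_N.+1} | P (\sum_(j < r) i j)%N)
      tuple_weight i * t ^+ (\sum_(j < r) i j)%N
      * q ^+ (\sum_(j < r | (j < s)%N) i j)%N * F i in
  (1 + a s * z s * t) * S (fun i => q ^+ i s) (fun n => n <= N)%N
  - (1 - a s * t) * S (fun=> 1) (fun n => n <= N)%N
  = a s * t * S (fun i => 1 + z s * q ^+ i s) (fun n => n == N)%N.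
Proof.
move=> S.
(* The factor [1 - q ^+ i s] kills the tuples with i_s = 0. For the others the recurrence lowers i_s
   by one, and the power of q coming from j < s does not change. *)
have incr : S (fun i => 1 - q ^+ i s) (fun n => n <= N)%N
    = a s * t * S (fun i => 1 + z s * q ^+ i s) (fun n => n < N)%N.
  rewrite /S mulr_sumr; apply: sum_tuple_incr => [i ->|i i' ii'].
    by rewrite subrr mulr0.
  have sumE P := sum_add_delta r P s (fun j => i j) (fun j => i' j) ii'.
  rewrite !sumE ltnn addn0 addn1 ii' eqxx addn1 exprS.
  have wE : tuple_weight i' * (1 - q ^+ (i s).+1)
      = a s * (1 + z s * q ^+ i s) * tuple_weight i.
    rewrite /tuple_weight (bigD1 s) //= [in RHS](bigD1 s) //= ii' eqxx addn1.
    rewrite mulrAC weightS -[LHS]mulrA; congr (_ * (_ * _)).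
    by apply: eq_bigr => j /negbTE js; rewrite ii' js addn0.
  set T := t ^+ _; set Q := q ^+ (\sum_(j < r | _) _)%N.
  transitivity (tuple_weight i' * (1 - q ^+ (i s).+1) * (t * T * Q)).
    by ring.
  rewrite wE; ring.
have split_le F : S F (fun n => n <= N)%N
    = S F (fun n => n < N)%N + S F (fun n => n == N)%N.
  rewrite /S (bigID (fun i : {ffun 'I_r -> 'I_N.+1} => \sum_j i j < N)%N) /=.
  by congr (_ + _); apply: eq_bigl => i; lia.
have lin1 : S (fun i => 1 - q ^+ i s) (fun n => n <= N)%N
    = S (fun=> 1) (fun n => n <= N)%N
      - S (fun i => q ^+ i s) (fun n => n <= N)%N.
  by rewrite /S -sumrB; apply: eq_bigr => i _; rewrite mulrBr.
have lin2 : S (fun i => 1 + z s * q ^+ i s) (fun n => n <= N)%N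
    = S (fun=> 1) (fun n => n <= N)%N
      + z s * S (fun i => q ^+ i s) (fun n => n <= N)%N.
  rewrite /S mulr_sumr -big_split; apply: eq_bigr => i _ /=.
  by rewrite mulrDr (mulrCA (z s)).
(* The sum over |i| = N is the full sum minus the one over |i| < N, which [incr] evaluates. *)
rewrite lin1 in incr; rewrite split_le in lin2.
move/(canRL (addKr _)): lin2 => ->.
rewrite mulrDr mulrN -incr; ring.
Qed.

Let ratio (t : A) (k : 'I_r) := (1 + a k * z k * t) / (1 - a k * t).

Lemma weight_series_dilate N (t : A) :
  (forall j, 1 - a j * t \is a GRing.unit) ->
  (\prod_(k < r) ratio t k) * weight_series N (t * q) - weight_series N t
  = \sum_(s < r) (a s * t / (1 - a s * t) * \prod_(k < r | (k < s)%N) ratio t k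
      * \sum_(i : {ffun 'I_r -> 'I_N.+1} | (\sum_(j < r) i j)%N == N)
          tuple_weight i * t ^+ N * q ^+ (\sum_(j < r | (j < s)%N) i j)%N
          * (1 + z s * q ^+ i s)).
Proof.
move=> tU.
(* [H s] is C_N with t replaced by tq in the coordinates below [s], times their ratios. It runs from
   C_N(t) at 0 to the fully dilated series at [r]. *)
pose H s := (\prod_(k < r | (k < s)%N) ratio t k)
  * \sum_(i : {ffun 'I_r -> 'I_N.+1} | (\sum_(j < r) i j <= N)%N)
      tuple_weight i * t ^+ (\sum_(j < r) i j)%N
      * q ^+ (\sum_(j < r | (j < s)%N) i j)%N.
have H0 : H 0%N = weight_series N t.
  rewrite /H big_pred0 // mul1r; apply: eq_bigr => i _.
  by rewrite [X in q ^+ X]big_pred0 // expr0 mulr1.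
have Hr : H r = (\prod_(k < r) ratio t k) * weight_series N (t * q).
  rewrite /H; congr (_ * _); first by apply: eq_bigl => k; rewrite ltn_ord.
  apply: eq_bigr => i _; rewrite exprMn mulrA; congr (_ * _ ^+ _).
  by apply: eq_bigl => k; rewrite ltn_ord.
rewrite -H0 -Hr -(telescope_sumr H (leq0n r)) big_mkord; apply: eq_bigr => s _.
have ratioS : \prod_(k < r | (k < s.+1)%N) ratio t k
    = ratio t s * \prod_(k < r | (k < s)%N) ratio t k.
  rewrite (bigD1 s) //=; congr (_ * _); apply: eq_bigl => k.
  by rewrite ltnS [in RHS]ltn_neqAle andbC.
have sumS (i : {ffun 'I_r -> 'I_N.+1}) :
    (\sum_(j < r | (j < s.+1)%N) i j
     = i s + \sum_(j < r | (j < s)%N) i j)%N.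
  rewrite (bigD1 s) //=; congr (_ + _)%N; apply: eq_bigl => k.
  by rewrite ltnS [in RHS]ltn_neqAle andbC.
have := truncation_step N s t; rewrite /=.
set S1 := \sum_(i : {ffun _ -> _} | _) _.
set S0 := \sum_(i : {ffun _ -> _} | _) _.
set SN := \sum_(i : {ffun _ -> _} | _) _.
move=> step; rewrite /H ratioS.
set S1' := \sum_(i : {ffun _ -> _} | _) _.
set S0' := \sum_(i : {ffun _ -> _} | _) _.
set SN' := \sum_(i : {ffun _ -> _} | _) _.
have -> : S1' = S1.
  by apply: eq_bigr => i _; rewrite sumS exprD mulrA mulrAC.
have -> : S0' = S0 by apply: eq_bigr => i _; rewrite mulr1.
have -> : SN' = SN by apply: eq_bigr => i /eqP->.
set p := \prod_(k < r | _) _.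
(* Over the common denominator 1 - a_s t, the increment of [H] becomes a multiple of the left-hand
   side of [truncation_step]. *)
have -> : ratio t s * p * S1 - p * S0
  = p * (1 - a s * t)^-1 * ((1 + a s * z s * t) * S1 - (1 - a s * t) * S0).
  by rewrite /ratio mulrBr [in RHS]mulrA
    [X in _ = _ - X]mulrA mulrVK ?tU //; ring.
rewrite step; ring.
Qed.

(** The inner sum of the N-th summand, with q^N freed into a variable t so that the dilation from t
    to tq applies. *)
Definition durfee_layer N (t : A) : A :=
  \sum_(i : {ffun 'I_r -> 'I_N.+1} | (\sum_(j < r) i j)%N == N)
    tuple_weight i * (1 + \sum_(s < r)
      q ^+ (\sum_(k < r | (k < s)%N) i k)%N * (1 + z s * q ^+ i s)
      * (a s * t / (1 - a s * t)) * \prod_(k < r | (k < s)%N) ratio t k).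

(** The leading 1 in the bracket accounts for raising the truncation from N to N + 1, and the sum
    over [s] for dilating C_(N+1). *)
Lemma durfee_layerE N (t : A) : (forall j, 1 - a j * t \is a GRing.unit) ->
  t ^+ N.+1 * durfee_layer N.+1 t
  = (\prod_(k < r) ratio t k) * weight_series N.+1 (t * q) - weight_series N t.
Proof.
move=> tU.
have -> : weight_series N t = weight_series N.+1 t
  - \sum_(i : {ffun 'I_r -> 'I_N.+2} | (\sum_(j < r) i j)%N == N.+1)
      tuple_weight i * t ^+ N.+1.
  apply/esym/eqP; rewrite subr_eq; apply/eqP; rewrite [LHS]/weight_series.
  rewrite (bigID (fun i : {ffun 'I_r -> 'I_N.+2} => \sum_j i j <= N)%N) /=.
  congr (_ + _).
    transitivity (\sum_(i : {ffun 'I_r -> 'I_N.+2} | (\sum_(j < r) i j <= N)%N)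
        tuple_weight i * t ^+ (\sum_(j < r) i j)%N).
      by apply: eq_bigl => i; apply/andb_idl/leqW.
    apply: sum_tuple_widen.
    move=> i i' ii'; congr (_ * _ ^+ _); last exact: eq_bigr.
    by apply: eq_bigr => j _; rewrite ii'.
  apply: eq_big => [i|i]; rewrite -ltnNge -eqn_leq //.
  by move=> /eqP->.
rewrite opprB addrCA weight_series_dilate // /durfee_layer.
under [in LHS]eq_bigr => i _ do rewrite mulrDr mulr1 mulr_sumr.
rewrite big_split /= mulrDr mulr_sumr; congr (_ + _).
  by apply: eq_bigr => i _; rewrite mulrC.
rewrite exchange_big /= mulr_sumr; apply: eq_bigr => s _.
rewrite !mulr_sumr; apply: eq_bigr => i _; ring.
Qed.

(** At t = q^(N+1) the ratios are exactly the factors taking P_N to P_(N+1), and t^(N+1) supplies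
    the square exponent. *)
Lemma durfee_step N : (forall j n, 1 - a j * q ^+ n.+1 \is a GRing.unit) ->
  let P n := \prod_(j < r)
    (qpoch (- a j * z j * q) q n / qpoch (a j * q) q n) in
  P N.+1 * weight_series N.+1 (q ^+ N.+2) - P N * weight_series N (q ^+ N.+1)
  = q ^+ (N.+1 ^ 2) * P N * durfee_layer N.+1 (q ^+ N.+1).
Proof.
move=> aU P.
have -> : P N.+1 = P N * \prod_(k < r) ratio (q ^+ N.+1) k.
  rewrite -big_split; apply: eq_bigr => j _ /=.
  have qpU n : qpoch (a j * q) q n \is a GRing.unit.
    by apply: rpred_prod => k _; rewrite -mulrA -exprS.
  rewrite !qpochS invrM ?qpU -?mulrA -?exprS // !mulNr opprK mulrA.
  rewrite /ratio; ring.
rewrite expnS expn1 exprM [RHS]mulrAC durfee_layerE // -exprSr.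
by ring.
Qed.

(** Only the zero tuple has sum 0; splitting it off leaves terms with a positive power of t, which
    vanish in the q-adic limit. *)
Lemma weight_series_head N (t : A) : weight_series N t
  = 1 + \sum_(i : {ffun 'I_r -> 'I_N.+1} | (0 < \sum_(j < r) i j <= N)%N)
          tuple_weight i * t ^+ (\sum_(j < r) i j)%N.
Proof.
pose i0 : {ffun 'I_r -> 'I_N.+1} := [ffun=> ord0].
have sum0 (i : {ffun 'I_r -> 'I_N.+1}) : (\sum_j i j == 0)%N = (i == i0).
  apply/idP/eqP => [|->]; last by rewrite big1 // => j _; rewrite ffunE.
  rewrite sum_nat_eq0 => /forallP i_eq0; apply/ffunP => j.
  by apply/val_inj; rewrite ffunE /=; apply/eqP/(implyP (i_eq0 j)).
have s0 : (\sum_j i0 j = 0)%N by apply/eqP; rewrite sum0.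
rewrite /weight_series (bigD1 i0) /=; last by rewrite s0.
congr (_ + _); last first.
  by apply: eq_bigl => i; rewrite lt0n sum0 andbC.
rewrite s0 expr0 mulr1; apply: big1 => j _.
by rewrite /weight ffunE expr0 /qpoch !big_ord0 invr1 !mulr1.
Qed.

End FiniteIdentity.

Arguments weight_series {A r}.
Arguments durfee_layer {A r}.

(** * Products and inverses of q-adic limits *)

Section Convergence.
Variable R : comUnitRingType.
Implicit Types (u v : nat -> {fps R}) (l : {fps R}).

(** Coefficient [n] of a product involves all lower coefficients of its factors, so a single
    threshold must serve for all of them. *)
Lemma fps_cvg_le u l : fps_cvg_to u l ->
  forall n, exists M, forall m, (M <= m)%N ->
    forall i, (i <= n)%N -> u m i = l i.
Proof.
move=> ul; elim=> [|n [M uM]].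
  by have [M uM] := ul 0%N; exists M => m /uM + [].
have [M' uM'] := ul n.+1; exists (maxn M M') => m; rewrite geq_max.
move=> /andP[leMm leM'm] i; rewrite leq_eqVlt.
move=> /predU1P[->|]; first exact: uM'.
by rewrite ltnS => /(uM _ leMm).
Qed.

Lemma fps_cvgM u v l l' : fps_cvg_to u l -> fps_cvg_to v l' ->
  fps_cvg_to (fun m => u m * v m) (l * l').
Proof.
move=> /fps_cvg_le ul /fps_cvg_le vl n.
have [M uM] := ul n; have [M' vM'] := vl n; exists (maxn M M') => m.
rewrite geq_max => /andP[leMm leM'm]; rewrite !fps_coefM.
by apply: eq_bigr => i _; rewrite uM ?vM' ?leq_subr // -ltnS.
Qed.

Lemma fps_cvg_prod (I : Type) (s : seq I) (u : I -> nat -> {fps R})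
    (l : I -> {fps R}) :
  (forall i, fps_cvg_to (u i) (l i)) ->
  fps_cvg_to (fun m => \prod_(i <- s) u i m) (\prod_(i <- s) l i).
Proof.
move=> ul; elim: s => [|i s IHs].
  by move=> n; exists 0%N => m _; rewrite !big_nil.
have usl := fps_cvgM (u i) _ _ _ (ul i) IHs; move=> n; have [M uM] := usl n.
by exists M => m /uM; rewrite !big_cons.
Qed.

Lemma fps_cvgV u l : (forall m, u m \is a GRing.unit) -> l \is a GRing.unit ->
  fps_cvg_to u l -> fps_cvg_to (fun m => (u m)^-1) l^-1.
Proof.
move=> uU lU /fps_cvg_le ul n; have [M uM] := ul n; exists M => m leMm.
apply/eqP; rewrite -subr_eq0 -fps_coefB.
(* The difference of inverses is a multiple of [l - u m], whose coefficients up to [n] vanish. *)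
have -> : (u m)^-1 - l^-1 = (l - u m) * ((u m)^-1 * l^-1).
  by rewrite mulrBl mulrCA divrr // mulr1 mulrA divrr // mul1r.
rewrite fps_coefM big1 // => i _.
by rewrite fps_coefB uM ?subrr ?mul0r // -ltnS.
Qed.

End Convergence.

(** * Summing the telescoping series *)

Section InfiniteIdentity.
Variables (R : comUnitRingType) (r : nat) (a z : 'I_r -> {fps R}).
Let q : {fps R} := fpsX.

Let qX0 : q 0%N = 0.
Proof. by []. Qed.

Lemma subr_fpsXn_unit (c : {fps R}) n : 1 - c * q ^+ n.+1 \is a GRing.unit.
Proof.
rewrite fps_unitE fps_coefB fps_coef1 exprS mulrCA fps_coefM0 qX0 mul0r subr0.
exact: unitr1.
Qed.

(** Every term other than the leading 1 is divisible by q^(N+1), hence invisible at q^n once n <=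
    N. *)
Lemma weight_series_cvg :
  fps_cvg_to (fun N => weight_series a z q N (q ^+ N.+1)) 1.
Proof.
move=> n; exists n => N lenN; rewrite weight_series_head fps_coefD fps_coef_sum.
rewrite big1 ?addr0 // => i /andP[+ _].
case: (\sum_j i j)%N => // d _; rewrite mulrC exprS -mulrA.
exact: fps_expM_low.
Qed.

Lemma qpoch_prod_durfee :
  (\prod_(j < r) qpoch_inf (- a j * z j * q) q)
    / (\prod_(j < r) qpoch_inf (a j * q) q)
  = 1 + fps_sum 1 (fun N => q ^+ (N ^ 2)
      * (\prod_(j < r) (qpoch (- a j * z j * q) q N.-1
                        / qpoch (a j * q) q N.-1))
      * durfee_layer a z q N (q ^+ N)).
Proof.
pose P n := \prod_(j < r) (qpoch (- a j * z j * q) q n / qpoch (a j * q) q n).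
pose S N := P N * weight_series a z q N (q ^+ N.+1).
set L := LHS; set F := (F in fps_sum 1 F).
have S_cvg : fps_cvg_to S L.
  rewrite -[L]mulr1; apply: fps_cvgM weight_series_cvg.
  rewrite /L prodrV => [|j]; last exact: qpoch_inf_unit.
  rewrite -big_split /=; apply: fps_cvg_prod => j.
  apply: fps_cvgM; first exact: qpoch_inf_cvg.
  apply: fps_cvgV => [m||]; [exact: qpoch_unit|exact: qpoch_inf_unit|].
  exact: qpoch_inf_cvg.
have S0 : S 0%N = 1.
  rewrite /S weight_series_head big_pred0 ?addr0 ?mulr1 => [|i]; last first.
    by rewrite ltnNge andNb.
  by apply: big1 => j _; rewrite /qpoch !big_ord0 divr1.
have qU n : 1 - q ^+ n.+1 \is a GRing.unit.
  by rewrite -[q ^+ _]mul1r subr_fpsXn_unit.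
have aU j n : 1 - a j * q ^+ n.+1 \is a GRing.unit by apply: subr_fpsXn_unit.
have sumF M : \sum_(1 <= N < M.+1) F N = S M - 1.
  rewrite big_add1 /= -S0 -(telescope_sumr S (leq0n M)); apply: eq_bigr => N _.
  by rewrite /F /= -durfee_step.
suff -> : fps_sum 1 F = L - 1 by rewrite addrC subrK.
(* The partial sum with exclusive upper bound [m.+1] is [S m - 1], hence the threshold [M.+1]. *)
apply: fps_cvg_lim => n; have [M SM] := S_cvg n; exists M.+1 => -[//|m] leMm.
by rewrite sumF fps_coefB SM.
Qed.

(** The [a j] and [z j] may be arbitrary power series, because 1 - a_j q^(n+1) always has constant
    term 1. What is left is to unfold the weights into quotients. *)
Lemma qpoch_prod_expansion :
  (\prod_(j < r) qpoch_inf (- a j * z j * q) q)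
    / (\prod_(j < r) qpoch_inf (a j * q) q)
  = 1 + fps_sum 1 (fun N =>
      q ^+ (N ^ 2)
      * (\prod_(j < r) (qpoch (- a j * z j * q) q N.-1
                        / qpoch (a j * q) q N.-1))
      * \sum_(i : {ffun 'I_r -> 'I_N.+1} | (\sum_(j < r) i j)%N == N)
          ((\prod_(j < r) a j ^+ i j) * (\prod_(j < r) qpoch (- z j) q (i j))
             / (\prod_(j < r) qpoch q q (i j))
           * (1 + \sum_(s < r)
                    q ^+ (\sum_(k < r | (k < s)%N) i k)%N
                    * (1 + z s * q ^+ i s)
                    * (a s * q ^+ N / (1 - a s * q ^+ N))
                    * \prod_(k < r | (k < s)%N)
                        ((1 + a k * z k * q ^+ N) / (1 - a k * q ^+ N))))).
Proof.
rewrite qpoch_prod_durfee; congr (1 + fps_sum 1 _).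
apply: boolp.funext => N; congr (_ * _); apply: eq_bigr => i _.
rewrite tuple_weightE // => n.
by rewrite -[q ^+ _]mul1r subr_fpsXn_unit.
Qed.

End InfiniteIdentity.

Theorem theorem1p2 (R : idomainType) (r : nat) (hr : (1 <= r)%N) :
  let a (j : 'I_r) : {fps {mpoly R[r + r]}} := ('X_(lshift r j))%:S in
  let z (j : 'I_r) : {fps {mpoly R[r + r]}} := ('X_(rshift r j))%:S in
  let q : {fps {mpoly R[r + r]}} := fpsX in
  (\prod_(j < r) qpoch_inf (- a j * z j * q) q)
    / (\prod_(j < r) qpoch_inf (a j * q) q)
  = 1 + fps_sum 1 (fun N =>
      q ^+ (N ^ 2)
      * (\prod_(j < r) (qpoch (- a j * z j * q) q N.-1
                        / qpoch (a j * q) q N.-1))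
      * \sum_(i : {ffun 'I_r -> 'I_N.+1} | (\sum_(j < r) i j)%N == N)
          ((\prod_(j < r) a j ^+ i j) * (\prod_(j < r) qpoch (- z j) q (i j))
             / (\prod_(j < r) qpoch q q (i j))
           * (1 + \sum_(s < r)
                    q ^+ (\sum_(k < r | (k < s)%N) i k)%N
                    * (1 + z s * q ^+ i s)
                    * (a s * q ^+ N / (1 - a s * q ^+ N))
                    * \prod_(k < r | (k < s)%N)
                        ((1 + a k * z k * q ^+ N) / (1 - a k * q ^+ N))))).
Proof. by move=> a z q; apply: qpoch_prod_expansion. Qed.
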